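(* Let $K$ be a field and let $(\lambda)=(\lambda_s)_{s\ge 1}$ and $(\lambda')=(\lambda'_s)_{s\ge 1}$ be sequences in $K$. The Lie algebras $L_{(\lambda)}$ and $L_{(\lambda')}$ are isomorphic if and only if $(\lambda')$ is obtained from $(\lambda)$ by a change of basis of type $\nu$, that is, if and only if there exist $c_0,c_1,d_1\in K$ with $c_0d_1\ne 0$ such that the elements of $L_{(\lambda)}$ defined by $$a'=c_0a+c_1e_1,\qquad e'_1=d_1e_1,\qquad e'_{i+1}=[a',e'_i]\ \ (i\ge 1)$$ satisfy $$[e'_1,e'_i]=\sum_{j\ge 1}\lambda'_j\,e'_{1+i+j}\quad\text{for all } i\ge 2.$$
   Context: For a sequence $(\lambda)=(\lambda_s)_{s\ge 1}$ of elements of a field $K$, $L_{(\lambda)}$ denotes the Lie algebra with (topological) basis $a,e_1,e_2,\ldots$ and multiplication $[a,e_i]=e_{i+1}$ for $i\ge 1$, $[e_1,e_i]=\sum_{j\ge 1}\lambda_j e_{1+i+j}$ for $i\ge 2$, and $[e_i,e_j]=0$ for $i,j\ge 2$. Infinite sums are allowed: the underlying vector space consists of all formal series $\alpha a+\sum_{i\ge 1}\beta_i e_i$ with $\alpha,\beta_i\in K$, and the bracket is extended by bilinearity and continuity, explicitly $$\Big[\alpha a+\sum_i\beta_ie_i,\ \alpha' a+\sum_i\beta'_ie_i\Big]=\sum_{i\ge 1}(\alpha\beta'_i-\alpha'\beta_i)e_{i+1}+\sum_{i\ge 2}\sum_{j\ge 1}(\beta_1\beta'_i-\beta'_1\beta_i)\lambda_j\,e_{1+i+j}.$$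 Infinite sums of the $e'_i$ are understood in the same coordinatewise (product topology) sense. Isomorphism means isomorphism of Lie algebras over $K$. *)

(* Defs.v *)
From HB Require Import structures.
From mathcomp Require Import all_boot all_order all_algebra.
From mathcomp Require Import boolp functions.
From mathcomp Require Import ring zify.

Set Implicit Arguments.
Unset Strict Implicit.
Unset Printing Implicit Defensive.

Import GRing.Theory.
Local Open Scope ring_scope.

HB.mixin Record Lmodule_isLieAlgebra (K : fieldType) L of GRing.Lmodule K L := {
  lie : L -> L -> L;
  lieDl : forall x y z, lie (x + y) z = lie x z + lie y z;
  lieDr : forall x y z, lie x (y + z) = lie x y + lie x z;
  lieZl : forall k x y, lie (k *: x) y = k *: lie x y;
  lieZr : forall k x y, lie x (k *: y) = k *: lie x y;
  liexx : forall x, lie x x = 0;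
  lie_jacobi : forall x y z,
    lie x (lie y z) + lie y (lie z x) + lie z (lie x y) = 0
}.

#[short(type="lieAlgType")]
HB.structure Definition LieAlgebra (K : fieldType) :=
  {L of GRing.Lmodule K L & Lmodule_isLieAlgebra K L}.

Definition lie_isomorphic (K : fieldType) (L1 L2 : lieAlgType K) : Prop :=
  exists f : {linear L1 -> L2},
    bijective f /\ (forall x y, f (lie x y) = lie (f x) (f y)).

(* Sequences [lam] are indexed by s >= 1: the value [lam 0] is never used.
   A formal series  alpha a + \sum_(i >= 1) beta_i e_i  is encoded by the
   function x with x 0 = alpha and x i = beta_i for i >= 1. *)
Definition Llam (K : fieldType) (lam : nat -> K) : Type := nat -> K.

Section LieAlgebraLlam.
Context {K : fieldType} (lam : nat -> K).

HB.instance Definition _ := GRing.Lmodule.copy (Llam lam) (nat -> K^o).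

(* The coefficient of e_n in  \sum_(i,j) (x_1 y_i - y_1 x_i) lam_j e_(1+i+j),
   i >= 2, j >= 1, comes from the pairs with j = n - 1 - i, i <= n - 2. *)
Definition Llam_lie (x y : Llam lam) : Llam lam := fun n : nat =>
  if (2 <= n)%N then
    (x 0%N * y n.-1 - y 0%N * x n.-1)
    + \sum_(2 <= i < n.-1) (x 1%N * y i - y 1%N * x i) * lam (n.-1 - i)%N
  else 0.

(* Llam_lie x y = x_0 T y - y_0 T x + x_1 B y - y_1 B x *)
Let T (x : Llam lam) n : K := if (2 <= n)%N then x n.-1 else 0.
Let B (x : Llam lam) n : K :=
  if (2 <= n)%N then \sum_(2 <= i < n.-1) x i * lam (n.-1 - i)%N else 0.

Let lieE x y n :
  Llam_lie x y n = x 0%N * T y n - y 0%N * T x n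
    + (x 1%N * B y n - y 1%N * B x n).
Proof.
rewrite /Llam_lie /T /B; case: ifP => _; last by ring.
congr (_ + _); rewrite !mulr_sumr -sumrB; apply: eq_bigr => i _; ring.
Qed.

Let TD x y n : T (x + y) n = T x n + T y n.
Proof. by rewrite /T; case: ifP => _; rewrite ?addr0. Qed.

Let BD x y n : B (x + y) n = B x n + B y n.
Proof.
rewrite /B; case: ifP => _; rewrite ?addr0 // -big_split /=.
by apply: eq_bigr => i _; rewrite -mulrDl.
Qed.

Let TZ k x n : T (k *: x) n = k * T x n.
Proof. by rewrite /T; case: ifP => _; rewrite ?mulr0. Qed.

Let BZ k x n : B (k *: x) n = k * B x n.
Proof.
rewrite /B; case: ifP => _; rewrite ?mulr0 // mulr_sumr.
by apply: eq_bigr => i _; rewrite mulrA.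
Qed.

Let addE (x y : Llam lam) n : (x + y) n = x n + y n :> K.
Proof. by []. Qed.
Let scaleE k (x : Llam lam) n : (k *: x) n = k * x n :> K.
Proof. by []. Qed.

Let Llam_lieDl x y z : Llam_lie (x + y) z = Llam_lie x z + Llam_lie y z.
Proof. by apply/funext => n; rewrite addE !lieE TD BD !addE; ring. Qed.

Let Llam_lieDr x y z : Llam_lie x (y + z) = Llam_lie x y + Llam_lie x z.
Proof. by apply/funext => n; rewrite addE !lieE TD BD !addE; ring. Qed.

Let Llam_lieZl k x y : Llam_lie (k *: x) y = k *: Llam_lie x y.
Proof. by apply/funext => n; rewrite scaleE !lieE TZ BZ !scaleE; ring. Qed.

Let Llam_lieZr k x y : Llam_lie x (k *: y) = k *: Llam_lie x y.
Proof. by apply/funext => n; rewrite scaleE !lieE TZ BZ !scaleE; ring. Qed.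

Let Llam_liexx x : Llam_lie x x = 0.
Proof.
by apply/funext => n; rewrite lieE -[(0 : Llam lam) n]/(0 : K); ring.
Qed.

Let BT x n : B (T x) n
  = T (B x) n + x 1%N * (if (4 <= n)%N then lam (n - 3)%N else 0).
Proof.
rewrite /B /T; case: n => [|[|[|[|n]]]] /=; rewrite ?mulr0 ?addr0 //.
- by rewrite big_geq.
- by rewrite !big_geq ?addr0.
rewrite big_nat_recl //= addrC; congr (_ + _).
- by rewrite !big_add1; apply: eq_big_nat => -[|[|i]].
Qed.

Let TL x y n : T (Llam_lie x y) n
  = x 0%N * T (T y) n - y 0%N * T (T x) n
    + (x 1%N * T (B y) n - y 1%N * T (B x) n).
Proof. by rewrite {1}/T; case: ifP => h; rewrite ?lieE // /T h; ring. Qed.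

Let BL x y n : B (Llam_lie x y) n
  = x 0%N * B (T y) n - y 0%N * B (T x) n
    + (x 1%N * B (B y) n - y 1%N * B (B x) n).
Proof.
have -> : Llam_lie x y =
    x 0%N *: (T y : Llam lam) + (- y 0%N) *: (T x : Llam lam)
    + (x 1%N *: (B y : Llam lam) + (- y 1%N) *: (B x : Llam lam)).
  by apply/funext => i; rewrite !addE !scaleE lieE; ring.
by rewrite !BD !BZ; ring.
Qed.

Let Llam_lie_jacobi x y z :
  Llam_lie x (Llam_lie y z) + Llam_lie y (Llam_lie z x)
    + Llam_lie z (Llam_lie x y) = 0.
Proof.
have L0 u v : Llam_lie u v 0%N = 0 by [].
have L1 u v : Llam_lie u v 1%N = 0 by [].
apply/funext => n; rewrite !addE.
rewrite (lieE x (Llam_lie y z)) (lieE y (Llam_lie z x)) (lieE z (Llam_lie x y)).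
rewrite !L0 !L1 !TL !BL !BT.
by rewrite -[(0 : Llam lam) n]/(0 : K); ring.
Qed.

HB.instance Definition _ := Lmodule_isLieAlgebra.Build K (Llam lam)
  Llam_lieDl Llam_lieDr Llam_lieZl Llam_lieZr Llam_liexx Llam_lie_jacobi.

Definition La : Llam lam := fun n => (n == 0%N)%:R.

(* Only meaningful for i >= 1. *)
Definition Le (i : nat) : Llam lam := fun n => (n == i)%:R.

(* x = \sum_(j >= 1) u j  in the product topology, K being discrete. *)
Definition sums_to (u : nat -> Llam lam) (x : Llam lam) : Prop :=
  forall n, exists N, forall m, (N <= m)%N -> (\sum_(1 <= j < m) u j) n = x n.

Lemma lie_a_e i : (1 <= i)%N -> lie La (Le i) = Le i.+1.
Proof.
move=> i1; apply/funext => n; rewrite -[LHS]/(Llam_lie La (Le i) n).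
rewrite /Llam_lie big1_seq => [|j /andP[_]]; last first.
  rewrite mem_index_iota /La => /andP[j2 _].
  by rewrite (gtn_eqF (ltnW j2)) /=; ring.
rewrite /La /Le (ltn_eqF i1) addr0 mul1r mul0r subr0.
by case: n => [|[|n]] //=; case: i i1.
Qed.

Lemma lie_e1_e i : (2 <= i)%N ->
  sums_to (fun j => lam j *: Le (1 + i + j)%N) (lie (Le 1) (Le i)).
Proof.
move=> i2 n; exists n => m nm; rewrite -[RHS]/(Llam_lie (Le 1) (Le i) n).
rewrite fct_sumE /Llam_lie /Le (ltn_eqF i2) !(ltn_eqF (ltnW i2)) /=.
transitivity (\sum_(1 <= j < m) lam j * (n == 1 + i + j)%N%:R) => //.
have [ltin|leni] := ltnP i n.-1; last first.
  rewrite big1_seq => [|j /andP[_]]; last first.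
    rewrite mem_index_iota => /andP[j1 _].
    by rewrite (_ : (n == _) = false) ?mulr0 //; lia.
  rewrite big1_seq => [|j /andP[_]]; first by case: ifP => // _; ring.
  rewrite mem_index_iota => /andP[j2 jn].
  by rewrite (_ : (j == i) = false) /=; [ring | lia].
rewrite ifT; last by lia.
rewrite (bigD1_seq (n.-1 - i)%N) ?iota_uniq //=; last first.
  by rewrite mem_index_iota; lia.
rewrite big1_seq => [|j /andP[jE]]; last first.
  rewrite mem_index_iota => /andP[j1 _].
  by rewrite (_ : (n == _) = false) ?mulr0 //; lia.
rewrite (bigD1_seq i) ?iota_uniq //=; last by rewrite mem_index_iota; lia.
rewrite big1_seq => [|j /andP[jE _]]; last by rewrite (negbTE jE) /=; ring.
rewrite (_ : (n == _) = true) ?eqxx /=; [ring | lia].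
Qed.

Lemma lie_e_e i j : (2 <= i)%N -> (2 <= j)%N -> lie (Le i) (Le j) = 0.
Proof.
move=> i2 j2; apply/funext => n; rewrite -[LHS]/(Llam_lie (Le i) (Le j) n).
case: i i2 => [|[|i]] // _; case: j j2 => [|[|j]] // _.
rewrite /Llam_lie /Le /= big1 => [|k _]; last by ring.
by rewrite !mul0r subrr addr0; case: ifP.
Qed.

Definition nu_a (c0 c1 : K) : Llam lam := c0 *: La + c1 *: Le 1.

(* The family e'_i, i >= 1; the value at i = 0 is not used. *)
Definition nu_e (c0 c1 d1 : K) (i : nat) : Llam lam :=
  iter i.-1 (lie (nu_a c0 c1)) (d1 *: Le 1).

Definition change_of_basis_nu (lam' : nat -> K) : Prop :=
  exists c0 c1 d1 : K, c0 * d1 != 0 /\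
    let e' := nu_e c0 c1 d1 in
    forall i, (2 <= i)%N ->
      sums_to (fun j => lam' j *: e' (1 + i + j)%N) (lie (e' 1%N) (e' i)).

End LieAlgebraLlam.

(* Main.v *)
(** In L_(lam), write M_m for the series supported on the indices >= m, so that
    M_2 is an abelian ideal.  Any y in M_(m+1) with m >= 1 is [a, x] for some
    x in M_m, hence every Lie isomorphism preserves M_m for m >= 2 and is
    automatically continuous.  On M_2, the element x acts only through its
    coordinates on a and e_1, and in L_(lam') one has
    [e_1, y] = \sum_j lam'_j (ad a)^(1+j) y for all y in M_2.  Transporting this
    identity along an isomorphism g : L_(lam') -> L_(lam) gives the change of
    basis of type nu in which c_0, c_1 are the coordinates of g a and d_1 is the
    coordinate of g e_1 on e_1; the coordinate of g e_1 on a vanishes because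
    e_1 maps M_2 to M_4.  Conversely, a change of basis of type nu is a
    triangular family, so it defines a continuous linear bijection, and brackets
    need only be compared on basis elements. *)

Require Import Defs.
From HB Require Import structures.
From mathcomp Require Import all_boot all_order all_algebra.
From mathcomp Require Import boolp functions.
From mathcomp Require Import ring zify.

Set Implicit Arguments.
Unset Strict Implicit.
Unset Printing Implicit Defensive.

Import GRing.Theory.
Local Open Scope ring_scope.

(** * Symmetry of isomorphism and of the bracket up to sign *)

Lemma lie_isomorphic_sym (K : fieldType) (L1 L2 : lieAlgType K) :
  lie_isomorphic L1 L2 -> lie_isomorphic L2 L1.
Proof.
move=> [f [[g fK gK] fM]].
have g_linear : linear g.
  by move=> k x y; apply: (can_inj fK); rewrite linearP !gK.
pose gL := HB.pack_for {linear L2 -> L1} g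
  (GRing.isLinear.Build K L2 L1 *:%R g g_linear).
exists gL; split; first by exists f.
by move=> x y; apply: (can_inj fK); rewrite /= fM !gK.
Qed.

Lemma lieC (K : fieldType) (L : lieAlgType K) (x y : L) : lie x y = - lie y x.
Proof.
apply/eqP; rewrite -addr_eq0; apply/eqP.
by have := liexx (x + y); rewrite lieDl !lieDr !liexx add0r addr0.
Qed.

(** The subspace M_m, stated on bare sequences so as to serve both algebras. *)
Definition vanish_below (K : fieldType) (m : nat) (x : nat -> K) : Prop :=
  forall n, (n < m)%N -> x n = 0.

Lemma vanish_belowW (K : fieldType) (m p : nat) (x : nat -> K) :
  (p <= m)%N -> vanish_below m x -> vanish_below p x.
Proof. by move=> pm xm n np; apply/xm/(leq_trans np). Qed.

(** * The bracket of L_(lam) in coordinates *)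

Section Coordinates.
Variables (K : fieldType) (lam : nat -> K).
Implicit Types x y z : Llam lam.

Lemma LlamDE x y n : (x + y) n = x n + y n. Proof. by []. Qed.
Lemma LlamNE x n : (- x) n = - x n. Proof. by []. Qed.
Lemma LlamZE k x n : (k *: x) n = k * x n. Proof. by []. Qed.
Lemma Llam0E n : (0 : Llam lam) n = 0. Proof. by []. Qed.

Lemma lie_coord x y n : (lie x y) n =
  if (2 <= n)%N then
    (x 0%N * y n.-1 - y 0%N * x n.-1)
    + \sum_(2 <= i < n.-1) (x 1%N * y i - y 1%N * x i) * lam (n.-1 - i)%N
  else 0.
Proof. by []. Qed.

Lemma lie_vanish_below x y m : vanish_below m y -> vanish_below m (lie x y).
Proof.
move=> ym n nm; rewrite lie_coord; case: ifP => // n2.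
rewrite !ym; [|lia..]; rewrite mulr0 mul0r subrr add0r big1_seq // => i.
rewrite mem_index_iota => /andP[_ iP].
by rewrite !ym; [ring | lia..].
Qed.

Lemma lie_vanish_below2 x y : vanish_below 2 (lie x y).
Proof. by move=> n n2; rewrite lie_coord ifF //; lia. Qed.

Lemma lie_vanish_belowS x y m :
  (2 <= m)%N -> vanish_below m y -> vanish_below m.+1 (lie x y).
Proof.
move=> m2 ym n nm; rewrite lie_coord; case: ifP => // n2.
rewrite !ym; [|lia..]; rewrite mulr0 mul0r subrr add0r big1_seq // => i.
rewrite mem_index_iota => /andP[_ iP].
by rewrite !ym; [ring | lia..].
Qed.

Lemma lie_on_M2 x x' y : vanish_below 2 y ->
  x 0%N = x' 0%N -> x 1%N = x' 1%N -> lie x y = lie x' y.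
Proof.
move=> y2 x0 x1; apply/funext => n.
rewrite !lie_coord !(y2 0%N) // !(y2 1%N) // x0 x1; case: ifP => // _.
rewrite !mul0r; congr (_ + _).
by apply: eq_bigr => i _; rewrite !mul0r.
Qed.

Lemma lie_M2_M2 x y : vanish_below 2 x -> vanish_below 2 y -> lie x y = 0.
Proof.
move=> x2 y2; rewrite (@lie_on_M2 x 0 y) ?x2 //.
by rewrite -[X in lie X _](scale0r 0) lieZl scale0r.
Qed.

Lemma lie_a_coord y : vanish_below 2 y -> lie (La lam) y = y \o predn.
Proof.
move=> y2; apply/funext => n; rewrite lie_coord (y2 0%N) // (y2 1%N) //=.
case: ifP => n2; last by rewrite y2 //; lia.
by rewrite big1 => [|i _]; rewrite /La /=; ring.
Qed.

Lemma lie_a_surj x m : (1 <= m)%N -> vanish_below m.+1 x ->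
  exists2 y, vanish_below m y & x = lie (La lam) y.
Proof.
(* Since ad a raises indices by one, a preimage is x shifted down. *)
move=> m1 xm; exists (fun n => if n is 0%N then 0 else x n.+1).
  by case=> [|n] nm //; apply: xm.
apply/funext => n; rewrite lie_coord.
case: ifP => n2; last by rewrite xm //; lia.
rewrite big1_seq => [|i]; last first.
  rewrite mem_index_iota => /andP[_ /andP[i2 _]].
  by rewrite /La (gtn_eqF (ltnW i2)) /=; ring.
by case: n n2 => [|[|n]] //= _; rewrite /La /=; ring.
Qed.

(** For n <= k the truncated [n - k] is 0, and y 0 = 0 since y is in M_2. *)
Lemma iter_lie_a_coord y k : vanish_below 2 y ->
  vanish_below 2 (iter k (lie (La lam)) y) /\
  forall n, iter k (lie (La lam)) y n = y (n - k)%N.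
Proof.
move=> y2; elim: k => [|k [IH2 IH]]; first by split=> // n; rewrite subn0.
split=> [|n]; first exact: lie_vanish_below.
by rewrite iterS lie_a_coord //= IH; congr (y _); lia.
Qed.

Lemma lie_e1_M2 y : vanish_below 2 y ->
  sums_to (fun j => lam j *: iter j.+1 (lie (La lam)) y) (lie (Le lam 1) y).
Proof.
move=> y2 n; exists n => m nm.
rewrite fct_sumE lie_coord (y2 0%N) // (y2 1%N) //.
transitivity (\sum_(1 <= j < m) lam j * y (n - j.+1)%N).
  by apply: eq_bigr => j _; rewrite LlamZE (iter_lie_a_coord _ y2).2.
case: ifP => n2; last first.
  by rewrite big1 // => j _; rewrite y2 ?mulr0 //; lia.
rewrite /Le /= !mul0r !subrr add0r.
have [n3|] := leqP 3 n; last by move=> n3; rewrite !big1_seq // => i;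
  rewrite mem_index_iota => /andP[_ iP]; [lia | rewrite y2 ?mulr0 //; lia].
(* For j >= n - 2 the index n - j - 1 is below 2, so the term vanishes; on the rest, the
   substitution i = n - 1 - j gives the sum in the bracket. *)
rewrite (@big_cat_nat _ _ _ n.-2) /=; [|lia..].
rewrite [X in _ + X]big1_seq ?addr0 => [|i]; last first.
  by rewrite mem_index_iota => /andP[_ iP]; rewrite y2 ?mulr0 //; lia.
rewrite [RHS]big_nat_rev [RHS]big_add1 [RHS]/=; apply: eq_big_nat => j jP.
by rewrite mul1r mul0r subr0 mulrC; congr (y _ * lam _); lia.
Qed.

(** The series of [e_1, e_i] starts at e_(i+2). *)
Lemma lie_e1_vanish y : vanish_below 2 y -> vanish_below 4 (lie (Le lam 1) y).
Proof.
move=> y2 n n4; rewrite lie_coord (y2 0%N) // (y2 1%N) //.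
case: ifP => // n2; rewrite big_geq; last lia.
by rewrite /Le /=; ring.
Qed.

Lemma nu_a_coord c0 c1 n :
  nu_a lam c0 c1 n = c0 * (n == 0%N)%:R + c1 * (n == 1%N)%:R.
Proof. by []. Qed.

Lemma nu_e_vanish c0 c1 d1 i : vanish_below i (nu_e lam c0 c1 d1 i).
Proof.
case: i => [|i] //; elim: i => [|i IH].
  by case=> // _; rewrite /nu_e /= LlamZE mulr0.
rewrite /nu_e [i.+2.-1]/= iterS; case: i IH => [|i] IH.
  exact: lie_vanish_below2.
exact: lie_vanish_belowS.
Qed.

(** Each step multiplies the leading coefficient by c0: the e_1 part of a' kills e'_1 and raises
    later indices by at least two. *)
Lemma nu_e_diag c0 c1 d1 i : nu_e lam c0 c1 d1 i.+1 i.+1 = c0 ^+ i * d1.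
Proof.
elim: i => [|i IH]; first by rewrite /nu_e /= LlamZE /Le expr0 mulr1 mul1r.
have ei := @nu_e_vanish c0 c1 d1 i.+1.
rewrite exprS -mulrA -IH {1}/nu_e [i.+2.-1]/= iterS -/(nu_e lam c0 c1 d1 i.+1).
rewrite lie_coord /= [X in _ + X]big1_seq => [|j]; last first.
  rewrite mem_index_iota => /andP[_]; case: j => [|[|j]] // /andP[_ ji].
  by rewrite ei // !nu_a_coord /=; ring.
have e0 : nu_e lam c0 c1 d1 i.+1 0%N = 0 by apply: ei.
by rewrite e0 nu_a_coord /=; ring.
Qed.

End Coordinates.

(** * Filtered maps and infinite sums *)

Section Filtered.
Variables (K : fieldType) (lam lam' : nat -> K).

(* A linear [f] with this property is continuous for the product topologies. *)
Definition filtered (f : Llam lam' -> Llam lam) : Prop :=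
  forall m, (2 <= m)%N -> forall x, vanish_below m x -> vanish_below m (f x).

(** M_2 contains every bracket; from there on, each bracket gains one level. *)
Lemma lie_morph_filtered (f : Llam lam' -> Llam lam) :
  (forall x y, f (lie x y) = lie (f x) (f y)) -> filtered f.
Proof.
move=> fM; case=> [|[|m]] // _; elim: m => [|m IH] x xm.
  have [y _ ->] := @lie_a_surj _ lam' _ _ (ltn0Sn _) xm.
  by rewrite fM; apply: lie_vanish_below2.
have [y /IH ym ->] := @lie_a_surj _ lam' _ _ (ltn0Sn _) xm.
by rewrite fM; apply: lie_vanish_belowS.
Qed.

Lemma sums_to_filtered (f : {linear Llam lam' -> Llam lam}) u x :
  filtered f -> sums_to u x -> sums_to (fun j => f (u j)) (f x).
Proof.
move=> ff ux n.
(* One N serves the first n + 2 coordinates; the 2 secures the bound on m in [filtered]. *)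
have [N NP] : exists N, forall m, (N <= m)%N ->
    vanish_below n.+2 (x - \sum_(1 <= j < m) u j).
  elim: (n.+2) => [|p [N NP]]; first by exists 0%N.
  have [N' N'P] := ux p; exists (maxn N N') => m.
  rewrite geq_max => /andP[Nm N'm].
  move=> i; rewrite ltnS leq_eqVlt => /orP[/eqP->|ip]; last exact: NP.
  by rewrite LlamDE LlamNE N'P // subrr.
exists N => m /NP xm; have := ff n.+2 isT _ xm n (leqnSn _).
rewrite raddfB raddf_sum LlamDE LlamNE => /eqP.
by rewrite subr_eq0 => /eqP.
Qed.

Lemma sums_to_unique (u : nat -> Llam lam) x y :
  sums_to u x -> sums_to u y -> x = y.
Proof.
move=> ux uy; apply/funext => n; have [N NP] := ux n; have [N' N'P] := uy n.
by rewrite -(NP (maxn N N')) ?leq_maxl // N'P ?leq_maxr.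
Qed.

Lemma filtered_eq0 (f : Llam lam' -> Llam lam) : linear f -> filtered f ->
  (forall i, f (Le lam' i) = 0) -> forall x, f x = 0.
Proof.
move=> f_lin ff f0 x; apply/funext => n; rewrite Llam0E.
(* Leading terms are stripped one by one until the remainder lies in M_(n+2), where [filtered]
   applies. *)
suff claim k y : (k <= n.+2)%N -> vanish_below (n.+2 - k) y -> f y n = 0.
  by apply: (claim n.+2 x) => // i; rewrite subnn.
elim: k y => [|k IH] y kn yk; first by rewrite (ff _ _ _ yk) // subn0.
pose p := (n.+2 - k.+1)%N.
have -> : y = y p *: Le lam' p + (y - y p *: Le lam' p).
  by rewrite addrC subrK.
rewrite f_lin f0 scaler0 add0r IH // 1?ltnW // => i ik.
rewrite LlamDE LlamNE LlamZE /Le; have [->|ip] := eqVneq i p.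
  by rewrite mulr1 subrr.
by rewrite mulr0 subr0 yk //; move: ip ik; rewrite /p; lia.
Qed.

End Filtered.

(** * Bijectivity of triangular changes of basis *)

Section Triangular.
Variables (K : fieldType) (lam lam' : nat -> K) (b : nat -> Llam lam).
Hypothesis b_vanish : forall i, vanish_below i (b i).

(* The series \sum_i y_i b_i, truncated at the indices i that contribute to the
   n-th coordinate by [b_vanish]. *)
Definition combine (y : Llam lam') : Llam lam :=
  fun n : nat => \sum_(i < n.+1) y i * b i n.

Lemma combine_linear : linear combine.
Proof.
move=> k y z; apply/funext => n.
rewrite LlamDE LlamZE /combine mulr_sumr -big_split.
by apply: eq_bigr => i _ /=; rewrite LlamDE LlamZE mulrDl mulrA.
Qed.

HB.instance Definition _ :=
  GRing.isLinear.Build K (Llam lam') (Llam lam) *:%R combine combine_linear.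

Lemma combine_filtered : filtered combine.
Proof.
move=> m _ y ym n nm; rewrite /combine big1 // => i _.
by rewrite ym ?mul0r //; apply: leq_trans nm.
Qed.

Lemma combine_Le i : combine (Le lam' i) = b i.
Proof.
apply/funext => n; rewrite /combine; have [ni|lein] := ltnP n i.
  rewrite b_vanish // big1 // => j _.
  by rewrite /Le ltn_eqF ?mul0r //; have := ltn_ord j; lia.
rewrite (bigD1 (Ordinal (lein : (i < n.+1)%N))) //= big1 => [|j ji].
  by rewrite /Le eqxx mul1r addr0.
by rewrite /Le (negbTE (ji : (val j != i))) mul0r.
Qed.

Hypothesis b_diag : forall i, b i i != 0.

Let combine_inj : injective combine.
Proof.
apply: raddf_inj => y y0; apply/funext => n; rewrite Llam0E.
elim/ltn_ind: n => n IH.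
have : combine y n = 0 by rewrite -[RHS](Llam0E lam n) -y0.
rewrite /combine big_ord_recr big1 => [|i _]; last by rewrite IH ?mul0r /=.
by rewrite /= add0r => /eqP; rewrite mulf_eq0 (negbTE (b_diag n)) orbF => /eqP.
Qed.

(** Forward elimination: [rem x n] is x minus the first n terms of its expansion in b, whose
    coefficients [solve] reads off. *)
Let rem (x : Llam lam) : nat -> Llam lam :=
  fix rem n := if n is n'.+1
    then rem n' - (rem n' n' / b n' n') *: b n' else x.

Let solve (x : Llam lam) : Llam lam' := fun n : nat => rem x n n / b n n.

Let remE x n m : rem x n m = x m - \sum_(i < n) solve x i * b i m.
Proof.
elim: n => [|n IH]; first by rewrite big_ord0 subr0.
by rewrite /= LlamDE LlamNE LlamZE IH big_ord_recr opprD addrA.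
Qed.

Let rem_vanish x n : vanish_below n (rem x n).
Proof.
elim: n => [|n IH] //= i; rewrite ltnS leq_eqVlt LlamDE LlamNE LlamZE.
case/orP => [/eqP->|ni]; first by rewrite divfK // subrr.
by rewrite IH // (b_vanish ni) mulr0 subr0.
Qed.

Lemma combine_bij : bijective combine.
Proof.
have solveK : cancel solve combine.
  move=> x; apply/funext => n; apply/esym/eqP.
  by rewrite -subr_eq0 -remE rem_vanish.
by exists solve => // y; apply: combine_inj; rewrite solveK.
Qed.

End Triangular.

(** * The two implications *)

Lemma change_of_basis_of_isomorphic (K : fieldType) (lam lam' : nat -> K) :
  lie_isomorphic (Llam lam') (Llam lam) -> change_of_basis_nu lam lam'.
Proof.
case=> g [[h gK hK] gM].
have hM x y : h (lie x y) = lie (h x) (h y).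
  by apply: (can_inj gK); rewrite gM !hK.
have gF := lie_morph_filtered gM; have hF := lie_morph_filtered hM.
set A := g (La lam'); set E := g (Le lam' 1).
(* [e_1, h e_2] lies in M_4, hence so does its image [E, e_2], whose e_3 coordinate is E 0. *)
have E0 : E 0%N = 0.
  have e2 : vanish_below 2 (Le lam 2) by case=> [|[|n]].
  have /(gF 4%N isT)/(_ 3%N isT) := lie_e1_vanish (hF 2%N isT _ e2).
  rewrite gM hK -/E lie_coord /= big_geq // /Le /=.
  by rewrite mulr1 mul0r subr0 addr0.
exists (A 0%N), (A 1%N), (E 1%N); split.
  (* The e_2 coordinate of [A, E] is A 0 * E 1; were it 0, then h [A, E] = e_2 would lie in M_3. *)
  apply/eqP => AE0; have : vanish_below 3 (lie A E).
    case=> [|[|[|n]]] // _.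
    by rewrite lie_coord /= big_geq // AE0 E0 mul0r subrr addr0.
  rewrite -gM lie_a_e // => /(hF 3%N isT)/(_ 2%N isT)/eqP.
  by rewrite gK /Le eqxx oner_eq0.
move=> e' i i2.
have e'2 j : (2 <= j)%N -> vanish_below 2 (e' j).
  by move=> j2; apply: vanish_belowW j2 _; apply: nu_e_vanish.
(* The identity for [e_1, h e'_i] is transported by g; on M_2, E acts as e'_1 and A as a'. *)
have := sums_to_filtered gF (lie_e1_M2 (hF 2%N isT _ (e'2 i i2))).
rewrite gM hK -/E (@lie_on_M2 _ _ E (e' 1%N)) //; last first.
- by rewrite /e' /nu_e /= LlamZE /Le mulr1.
- by rewrite /e' /nu_e /= LlamZE /Le mulr0.
- exact: e'2.
congr sums_to; apply/funext => j; rewrite linearZ; congr (_ *: _).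
have nu_iter k : g (iter k (lie (La lam')) (h (e' i))) = e' (k + i)%N.
  elim: k => [|k IH]; first by rewrite hK.
  rewrite iterS gM IH -/A (@lie_on_M2 _ _ A (nu_a lam (A 0%N) (A 1%N))).
  - by rewrite /e' /nu_e (_ : (k.+1 + i).-1 = (k + i).-1.+1) //; lia.
  - by apply: e'2; lia.
  - by rewrite nu_a_coord /=; ring.
  - by rewrite nu_a_coord /=; ring.
by rewrite nu_iter; congr e'; lia.
Qed.

Lemma isomorphic_of_change_of_basis (K : fieldType) (lam lam' : nat -> K) :
  change_of_basis_nu lam lam' -> lie_isomorphic (Llam lam') (Llam lam).
Proof.
case=> c0 [c1 [d1 [/[!mulf_eq0] /norP[c0N0 d1N0] e'P]]].
set e' := nu_e lam c0 c1 d1 in e'P.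
(* Index 0 encodes a, so a' takes that slot. *)
pose b i := if i is 0%N then nu_a lam c0 c1 else e' i.
have b_vanish i : vanish_below i (b i) by case: i => // i; apply: nu_e_vanish.
have b_diag i : b i i != 0.
  case: i => [|i]; first by rewrite /b nu_a_coord mulr1 mulr0 addr0.
  by rewrite /b /e' nu_e_diag mulf_neq0 // expf_neq0.
pose g : {linear Llam lam' -> Llam lam} := @combine K lam lam' b.
have gF : filtered g by apply: combine_filtered.
have gE i : g (Le lam' i) = b i by apply: combine_Le.
exists g; split; first exact: combine_bij.
(* The defect of g is bilinear and filtered in each argument, so it vanishes once it does on basis
   pairs. *)
pose D x y := g (lie x y) - lie (g x) (g y).
have D_antisym x y : D x y = - D y x.
  by rewrite /D lieC linearN [lie (g x) _]lieC opprB opprK addrC.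
have D_linear x : linear (D x).
  move=> k u v; rewrite /D lieDr lieZr !linearP lieDr lieZr scalerBr.
  by rewrite opprD addrACA.
have D_filtered x : filtered (D x).
  move=> m m2 u um n nm; rewrite /D LlamDE LlamNE.
  have /(_ n nm)-> := gF m m2 _ (@lie_vanish_below _ lam' x _ _ um).
  have /(_ n nm)-> := @lie_vanish_below _ lam (g x) _ _ (gF m m2 _ um).
  by rewrite subrr.
suff D_basis i j : D (Le lam' i) (Le lam' j) = 0.
  move=> x y; apply/eqP; rewrite -subr_eq0 -/(D x y); apply/eqP.
  apply: (filtered_eq0 (D_linear x) (D_filtered x)) => j.
  rewrite D_antisym (filtered_eq0 (D_linear _) (D_filtered _)) ?oppr0 //.
wlog ij : i j / (i <= j)%N.
  move=> wl; case: (leqP i j) => [|/ltnW] /wl // Dji.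
  by rewrite D_antisym Dji oppr0.
have [->|iNj] := eqVneq i j; first by rewrite /D !liexx linear0 subrr.
have {ij iNj} ij : (i < j)%N by rewrite ltn_neqAle iNj.
apply/eqP; rewrite subr_eq0 !gE; apply/eqP.
(* The pairs are a with e_j, e_1 with e_j, and two elements of the abelian ideal M_2. *)
case: i ij => [|[|i]] ij.
- rewrite -[Le lam' 0]/(La lam') lie_a_e // gE.
  by case: j ij.
- rewrite [b j](_ : _ = e' j); last by case: j ij.
  apply: sums_to_unique (e'P j ij).
  have := sums_to_filtered gF (lie_e1_e lam' ij).
  by congr sums_to; apply/funext => k; rewrite linearZ gE.
- have j2 : (2 <= j)%N by apply: leq_trans ij.
  rewrite lie_e_e // linear0 lie_M2_M2 //.
    exact: vanish_belowW (b_vanish _).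
  exact: vanish_belowW (b_vanish _).
Qed.

Theorem lemma3p1 (K : fieldType) (lam lam' : nat -> K) :
  lie_isomorphic (Llam lam) (Llam lam') <-> change_of_basis_nu lam lam'.
Proof.
(* The new basis lives in L_(lam), so isomorphisms are taken from L_(lam') to L_(lam). *)
split=> [/lie_isomorphic_sym|]; first exact: change_of_basis_of_isomorphic.
by move=> /isomorphic_of_change_of_basis/lie_isomorphic_sym.
Qed.
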